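(* Let $k\ge 0$ be an integer. If $G$ is a directed graph of treewidth (at most) $k$, then $f(G)\leq \frac{k}{k+3}\,n(G)$.
   Context: Directed graphs are oriented graphs: finite, no loops, no multiple arcs and no pair of antiparallel arcs. $n(G)$ is the number of vertices and $f(G)$ is the minimum size of a set $F\subseteq V(G)$ such that $G-F$ contains no directed cycle. An undirected graph is a $k$-tree if it has a vertex ordering $\phi$ such that, for each vertex $v$, the set of neighbours of $v$ preceding it is a clique of size exactly $\min(k,\phi(v)-1)$. An undirected graph has treewidth $k$ (in the sense used here: at most $k$) if it is a subgraph of a $k$-tree; a directed graph has treewidth $k$ if its underlying undirected graph does. *)

(* Defs.v *)
From mathcomp Require Import all_boot all_order.
Set Implicit Arguments. Unset Strict Implicit. Unset Printing Implicit Defensive.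

(* A directed graph (oriented graph) on a finite vertex type V is given by its
   arc relation: no loops, no pair of antiparallel arcs (multiple arcs are
   impossible in a relation). *)
Definition oriented (V : finType) (arc : rel V) : Prop :=
  irreflexive arc /\ (forall x y, arc x y -> ~~ arc y x).

Definition has_dicycle_in (V : finType) (arc : rel V) (S : {set V}) : Prop :=
  exists s : seq V, [/\ s != [::], uniq s, all (fun x => x \in S) s & cycle arc s].

Definition is_fvs (V : finType) (arc : rel V) (F : {set V}) : Prop :=
  ~ has_dicycle_in arc (~: F).

(* Undirected simple graph h on W is a k-tree: there is a vertex ordering phi
   (injective into positions 0..|W|-1; 0-based, so phi v = phi(v)-1 in the
   paper) such that the earlier neighbours of every v form a clique of size
   exactly min(k, phi v). *)
Definition ktree (k : nat) (W : finType) (h : rel W) : Prop :=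
  irreflexive h /\ symmetric h /\
  exists phi : W -> 'I_#|W|, injective phi /\
    forall v : W,
      let P := [set u | h u v & (phi u < phi v)%N] in
      (forall u w, u \in P -> w \in P -> u != w -> h u w) /\
      #|P| = minn k (phi v).

Definition underlying (V : finType) (arc : rel V) : rel V :=
  fun x y => arc x y || arc y x.

Definition tw_le (k : nat) (V : finType) (arc : rel V) : Prop :=
  exists (W : finType) (h : rel W) (iota : V -> W),
    [/\ ktree k h, injective iota &
        forall x y, underlying arc x y -> h (iota x) (iota y)].

(* Main.v *)
(** If every edge of a k-tree is oriented, a vertex set is acyclic as soon as it
contains no directed triangle.  It therefore suffices to find a set of at least
3/(k+3) of the vertices without directed triangles, and this is done by
reductions: delete a set D and keep a set R with 3|D| <= k|R|, such that every
directed triangle meeting R meets D, and continue with the remaining graph.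

The reductions are found near the leaves of the elimination tree.  The
descendants of v are separated from the rest by the clique of its at most k
earlier neighbours.  Let v be a last vertex with more than three descendants
(itself included), so that each child of v has one, two or three.  Three
descendants of a child, attached to a single vertex p that is not deleted, cost
only one deletion, since two of them lie on the same side of p.  If v has a
child with two descendants and another child, deleting all of v and its earlier
neighbours, or all but one, is paid for by these two subtrees.  Otherwise v is
kept with all its subtrees of one or three vertices, while its earlier
neighbours are deleted, except that one of them is spared if v has a single
child: it can be chosen not adjacent to the subtree of that child.  If no vertex
has more than three descendants, the components of the graph have at most three
vertices.  For k = 2 the same works with one descendant instead of three, and
for k <= 1 there are no triangles at all. *)

Require Import Defs.
From mathcomp Require Import all_boot all_order.
From mathcomp Require Import zify.

Set Implicit Arguments.
Unset Strict Implicit.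
Unset Printing Implicit Defensive.

(** * Cardinalities of small sets and of unions *)

Lemma card_le1_eq (T : finType) (Y : {set T}) x y : #|Y| <= 1 -> x \in Y -> y \in Y -> x = y.
Proof. by move=> /card_le1_eqP H xY yY; apply: H. Qed.

Lemma card_bigcup_le (I V : finType) (T : {set I}) (F : I -> {set V}) :
  #|\bigcup_(w in T) F w| <= \sum_(w in T) #|F w|.
Proof.
elim/big_rec2: _ => [|w m X _ le]; first by rewrite cards0.
by apply: leq_trans (leq_card_setU _ _) _; rewrite leq_add2l.
Qed.

Lemma card_bigcup_disjoint (I V : finType) (T : {set I}) (F : I -> {set V}) :
  {in T &, forall w w', w != w' -> [disjoint F w & F w']} ->
  #|\bigcup_(w in T) F w| = \sum_(w in T) #|F w|.
Proof.
move=> disF; pose G w := if w \in T then F w else set0.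
have -> : \bigcup_(w in T) F w = \bigcup_w G w.
  by rewrite big_mkcond /=; apply: eq_bigr => w _; rewrite /G; case: ifP.
have -> : \sum_(w in T) #|F w| = \sum_w #|G w|.
  by rewrite big_mkcond /=; apply: eq_bigr => w _; rewrite /G; case: ifP; rewrite ?cards0.
rewrite -sum1_card partition_disjoint_bigcup.
  by apply: eq_bigr => w _; rewrite sum1_card.
move=> w w' nww'; rewrite /G; case: ifP => wT; last by rewrite -setI_eq0 set0I.
by case: ifP => w'T; [apply: disF | rewrite -setI_eq0 setI0].
Qed.

(** * Triangles and cycles in an oriented graph with a perfect elimination order *)

Section EliminationOrder.

Variables (V : finType) (h arc : rel V) (phi : V -> nat) (k : nat).
Hypothesis h_irr : irreflexive h.
Hypothesis h_sym : symmetric h.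
Hypothesis phi_inj : injective phi.
Hypothesis h_chordal : forall u v w,
  h u w -> h v w -> phi u < phi w -> phi v < phi w -> u != v -> h u v.
Hypothesis h_back : forall v, #|[set u | h u v & phi u < phi v]| <= k.
Hypothesis arc_h : forall x y, arc x y -> h x y.
Hypothesis arc_asym : forall x y, arc x y -> ~~ arc y x.
Hypothesis arc_total : forall x y, h x y -> arc x y || arc y x.

Implicit Types (A R X : {set V}) (u v w x y z : V).

Definition dtriangle A x y z :=
  [&& x \in A, y \in A, z \in A, arc x y, arc y z & arc z x].

Lemma dtriangle_rot A x y z : dtriangle A x y z -> dtriangle A y z x.
Proof. by rewrite /dtriangle => /and5P[-> -> -> -> /andP[-> ->]]. Qed.

Lemma arc_irr x : arc x x = false.
Proof. by apply/negP=> /arc_h; rewrite h_irr. Qed.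

Lemma dtriangle_neq A x y z : dtriangle A x y z -> [/\ x != y, y != z & z != x].
Proof.
case/and5P=> _ _ _ xy /andP[yz zx].
by split; apply: contraTneq isT => e; subst; rewrite arc_irr in xy yz zx.
Qed.

(* In the cycle, the neighbours of the last vertex v in the order are adjacent;
   as they do not form a triangle with v, the arc between them bypasses v. *)
Lemma dtriangle_free_acyclic S :
  (forall x y z, ~~ dtriangle S x y z) -> ~ has_dicycle_in arc S.
Proof.
move=> tf [s]; move: {2}(size s) (leqnn (size s)) => n.
elim: n s => [|n IHn] s; first by case: s => // ? [].
move=> szs [s0 us sS cs].
have [v0 v0s] : exists v, v \in s by case: s s0 {szs us sS cs} => // a s _; exists a; rewrite mem_head.
case: (arg_maxnP phi v0s) => v vs vmax.
have [i s' def_s'] := rot_to vs.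
have us' : uniq (v :: s') by rewrite -def_s' rot_uniq.
have cs' : cycle arc (v :: s') by rewrite -def_s' rot_cycle.
have mem_s' x : x \in v :: s' -> x \in S /\ phi x <= phi v.
  rewrite -def_s' mem_rot => xs; split; first exact: (allP sS).
  exact: vmax.
have sz_s' : size s' < n.+1 by have := size_rot i s; rewrite def_s' /= => ->.
case: s' us' cs' mem_s' sz_s' {def_s'} => [|a s'] us' cs' mem_s' sz_s'.
  by move: cs'; rewrite /= arc_irr.
move: cs'; rewrite /= rcons_path => /and3P[va pa bv].
set b := last a s' in bv.
have bas : b \in a :: s' by exact: mem_last.
have vnas : v \notin a :: s' by case/andP: us'.
have nab : a != b.
  by apply: contraTneq va => ->; apply: arc_asym.
have lt_v x : x \in a :: s' -> phi x < phi v.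
  move=> xs; have [_] := mem_s' x (mem_behead (s := v :: _) xs).
  rewrite leq_eqVlt => /orP[/eqP/phi_inj e|//].
  by rewrite -e xs in vnas.
have ba : arc b a.
  have hab : h a b.
    apply: (h_chordal (w := v)) => //; [|exact: arc_h|by apply: lt_v; rewrite mem_head|exact: lt_v].
    by rewrite h_sym; apply: arc_h.
  case/orP: (arc_total hab) => // ab.
  have /negP[] := tf v a b; apply/and5P; split; last by rewrite ab bv.
  - by have [] := mem_s' v (mem_head _ _).
  - by have [] := mem_s' a (mem_behead (s := v :: _) (mem_head _ _)).
  - by have [] := mem_s' b (mem_behead (s := v :: _) bas).
  - exact: va.
apply: (IHn (a :: s')) => //; split=> //.
- by case/andP: us'.
- by apply/allP=> x xs; have [] := mem_s' x (mem_behead (s := v :: _) xs).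
- by rewrite /= rcons_path pa.
Qed.

(** [X] joins the kept set [R] and the deleted set [X :\: R], so the inequality amounts to
    [3 * #|X :\: R| <= k * #|R|]. *)
Definition reducible A := exists X R,
  [/\ X != set0, R \subset X, X \subset A, 3 * #|X| <= (k + 3) * #|R|
    & forall x y z, dtriangle A x y z -> x \in R ->
        (y \in X :\: R) || (z \in X :\: R)].

(** Induction on [#|A|]: the [R] of a reduction is added to the set found in [A :\: X]. A triangle
    of the union meeting [R] would contain a vertex of [X :\: R], which is disjoint from both. *)
Lemma large_dtriangle_free :
  (forall A, A != set0 -> reducible A) ->
  exists S : {set V}, (forall x y z, ~~ dtriangle S x y z) /\
     3 * #|V| <= (k + 3) * #|S|.
Proof.
move=> red.
suff H n A : #|A| <= n -> exists S : {set V}, [/\ S \subset A,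
    (forall x y z, ~~ dtriangle S x y z) & 3 * #|A| <= (k + 3) * #|S|].
  by have [S [_ ? ?]] := H _ setT (leqnn _); exists S; split=> //; rewrite -cardsT.
elim: n A => [|n IHn] A cA.
  have A0 : A = set0 by apply/eqP; rewrite -cards_eq0 -leqn0.
  by exists set0; split; rewrite ?sub0set ?A0 ?cards0 ?muln0 // => x y z; rewrite /dtriangle inE.
have [->|A0] := eqVneq A set0.
  by exists set0; split; rewrite ?sub0set ?cards0 ?muln0 // => x y z; rewrite /dtriangle inE.
have [X [R [X0 RX XA cX tX]]] := red A A0.
have cAX : #|A| = #|X| + #|A :\: X| by rewrite -(cardsID X A) (setIidPr XA).
have cX0 : 0 < #|X| by rewrite card_gt0.
have [|S [SA tS cS]] := IHn (A :\: X); first lia.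
have SX : [disjoint S & X] by apply: disjointWl SA _; rewrite -setI_eq0 setIDAC setDIl setDv setI0.
have dRS : [disjoint R & S] by rewrite disjoint_sym; apply: disjointWr RX SX.
have cU : #|R :|: S| = #|R| + #|S|.
  by rewrite cardsU (disjoint_setI0 dRS) cards0 subn0.
have SA' : S \subset A by apply: subset_trans SA (subsetDl _ _).
exists (R :|: S); split; last by rewrite cU cAX !mulnDr; lia.
  by rewrite subUset SA' (subset_trans RX XA).
have sub : R :|: S \subset A by rewrite subUset SA' (subset_trans RX XA).
have meetsR x y z : dtriangle (R :|: S) x y z -> x \notin R.
  move=> t; apply/negP=> xR; have /and5P[xs ys zs xy yzx] := t.
  have : dtriangle A x y z by rewrite /dtriangle !(subsetP sub) // xy yzx.
  move/tX=> /(_ xR)/orP[]; rewrite inE => /andP[nR inX];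
    [move: ys|move: zs]; rewrite inE (negPf nR) /= => inS;
    by rewrite (disjointFr SX inS) in inX.
move=> x y z; apply/negP=> t.
have nx := meetsR _ _ _ t.
have ny := meetsR _ _ _ (dtriangle_rot t).
have nz := meetsR _ _ _ (dtriangle_rot (dtriangle_rot t)).
have /negP[] := tS x y z.
by move: t; rewrite /dtriangle !inE (negPf nx) (negPf ny) (negPf nz).
Qed.

(** * The elimination tree of the graph induced on [A] *)

Section Subgraph.

Variable A : {set V}.

Definition down : rel V :=
  fun x y => [&& x \in A, y \in A, h x y & phi y < phi x].

Definition parents v := [set u | down v u].

Definition descendants v := [set y | connect down y v].

(** These are children in the elimination tree, where the tree parent of a vertex is the last of its
    [parents]. *)
Definition children v :=
  [set w | (v \in parents w) && [forall u in parents w, phi u <= phi v]].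

Lemma card_parents v : #|parents v| <= k.
Proof.
apply: leq_trans (h_back v); apply: subset_leq_card; apply/subsetP=> u.
by rewrite !inE => /and4P[_ _ hvu ->]; rewrite h_sym hvu.
Qed.

Lemma descendants_refl v : v \in descendants v.
Proof. by rewrite inE connect0. Qed.

Lemma connect_down_le x y : connect down x y -> phi y <= phi x.
Proof.
case/connectP=> p; elim: p x => [|z p IHp] x /=; first by move=> _ ->.
by case/andP=> /and4P[_ _ _ /ltnW lt_zx] /IHp H /H le_yz; apply: leq_trans lt_zx.
Qed.

Lemma descendants_sub v : v \in A -> descendants v \subset A.
Proof.
move=> vA; apply/subsetP=> y; rewrite inE => /connectP[[|z p] /=]; first by move=> _ <-.
by case/andP=> /and4P[].
Qed.

Lemma parents_sub v : parents v \subset A.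
Proof. by apply/subsetP=> u; rewrite inE => /and4P[]. Qed.

Lemma down_comparable x y z :
  down x y -> down x z -> [\/ y = z, down y z | down z y].
Proof.
case/and4P=> xA yA hxy yx /and4P[_ zA hxz zx].
case: (eqVneq y z) => [->|nyz]; first by constructor 1.
have hyz : h y z by apply: (h_chordal (w := x)); rewrite // h_sym.
case: (ltngtP (phi y) (phi z)) => [lt|lt|/phi_inj e].
- by constructor 3; rewrite /down zA yA h_sym hyz.
- by constructor 2; rewrite /down zA yA hyz.
- by rewrite e eqxx in nyz.
Qed.

(** Induction along the path from [y] down to [v]: [x] and the next vertex [z] are equal or adjacent
    by chordality. If [x] is the later one, it reaches [v] through [z]; otherwise [z] takes the
    place of [y]. *)
Lemma descendants_step v y x :
  y \in descendants v -> down y x -> x \in descendants v :|: parents v.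
Proof.
rewrite inE => /connectP[p]; elim: p y => [|z p IHp] y /=.
  by move=> _ <- dyx; rewrite !inE dyx orbT.
case/andP=> dyz pz lz dyx.
have zv : connect down z v by apply/connectP; exists p.
case: (down_comparable dyz dyx) => [<-|dzx|dxz].
- by rewrite !inE zv.
- exact: IHp pz lz dzx.
- by rewrite !inE (connect_trans (connect1 dxz) zv).
Qed.

Lemma descendants_nbr v y x : v \in A ->
  y \in descendants v -> x \in A -> h x y -> x \in descendants v :|: parents v.
Proof.
move=> vA yv xA hxy; have yA := subsetP (descendants_sub vA) y yv.
case: (ltngtP (phi x) (phi y)) => [lt|lt|/phi_inj e].
- by apply: descendants_step yv _; rewrite /down yA xA h_sym hxy.
- have dxy : down x y by rewrite /down yA xA hxy.
  by move: yv; rewrite !inE => /(connect_trans (connect1 dxy)) ->.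
- by rewrite e h_irr in hxy.
Qed.

Lemma children_in v w : w \in children v -> w \in A.
Proof. by rewrite !inE => /andP[/and4P[]]. Qed.

Lemma children_gt v w : w \in children v -> phi v < phi w.
Proof. by rewrite !inE => /andP[/and4P[]]. Qed.

Lemma parents_child v w : w \in children v -> parents w \subset v |: parents v.
Proof.
rewrite inE => /andP[]; rewrite inE => dwv /forall_inP le_v; apply/subsetP=> u uw.
have le_uv := le_v u uw; move: uw; rewrite !inE => dwu.
case: (down_comparable dwu dwv) => [->|duv|->]; rewrite ?eqxx ?orbT //.
by case/and4P: duv => _ _ _; rewrite ltnNge le_uv.
Qed.

Lemma descendants_child v y : y \in descendants v -> y != v ->
  exists2 w, w \in children v & y \in descendants w.
Proof.
rewrite inE => /connectP[p]; elim: p y => [|z p IHp] y /=.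
  by move=> _ ->; rewrite eqxx.
case/andP=> dyz pz lz nyv.
have [ezv|nzv] := eqVneq z v; last first.
  have [w wv zw] := IHp z pz lz nzv; exists w => //.
  by move: zw; rewrite !inE; apply: connect_trans (connect1 dyz).
move: dyz; rewrite {}ezv => dyv {pz lz z p IHp}.
(* The first vertex satisfying [Q] is a child: a parent of it after [v] would be adjacent to [v] and
   satisfy [Q] too. *)
pose Q w := [&& connect down y w, down w v & w != v].
have Q0 : Q y by rewrite /Q connect0 dyv.
case: (arg_minnP phi Q0) => w /and3P[yw dwv nwv] wmin.
exists w; last by rewrite inE.
rewrite !inE dwv /=; apply/forall_inP => u; rewrite inE => dwu.
rewrite leqNgt; apply/negP=> lt_vu.
have nuv : u != v by apply: contraTneq lt_vu => ->; rewrite ltnn.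
have duv : down u v.
  case: (down_comparable dwu dwv) => [e|//|/and4P[_ _ _ lt]].
    by rewrite e eqxx in nuv.
  by have := ltn_trans lt lt_vu; rewrite ltnn.
have := wmin u; rewrite /Q duv nuv (connect_trans yw (connect1 dwu)) => /(_ isT).
by case/and4P: dwu => _ _ _; rewrite ltnNge => /negP.
Qed.

Lemma child_not_descendant v w w' :
  w \in children v -> w' \in children v -> connect down w w' -> w = w'.
Proof.
move=> wv w'v /connectP[[|z p] /=]; first by move=> _ ->.
case/andP=> dwz pz lz; have zw' : connect down z w' by apply/connectP; exists p.
move: wv; rewrite inE => /andP[_ /forall_inP/(_ z)]; rewrite inE => /(_ dwz) le_zv.
by have := leq_trans (children_gt w'v) (leq_trans (connect_down_le zw') le_zv); rewrite ltnn.
Qed.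

(** A path from a common descendant down to [w] stays among the descendants of [w'] unless it enters
    a parent of [w'], so one of [w], [w'] reaches the other. *)
Lemma descendants_children_disjoint v w w' :
  w \in children v -> w' \in children v -> w != w' ->
  [disjoint descendants w & descendants w'].
Proof.
move=> wv w'v nww'; rewrite -setI_eq0; apply: contraNT nww' => /set0Pn[y].
rewrite inE => /andP[yw yw'].
have : connect down w w' \/ connect down w' w.
  move: yw; rewrite inE => /connectP[p].
  elim: p y yw' => [|z p IHp] y yw' /=; first by move=> _ e; left; rewrite inE -e in yw'.
  case/andP=> dyz pz lz.
  have := descendants_step yw' dyz; rewrite inE => /orP[zw'|]; first exact: IHp pz lz.
  rewrite inE => dw'z; right; apply: connect_trans (connect1 dw'z) _.
  by apply/connectP; exists p.
case=> [/(child_not_descendant wv w'v)->//|].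
by move/(child_not_descendant w'v wv)->.
Qed.

Lemma low_not_descendant v w u :
  w \in children v -> phi u <= phi v -> u \notin descendants w.
Proof.
move=> wv le_uv; apply/negP; rewrite inE => /connect_down_le le_wu.
by have := leq_trans (children_gt wv) (leq_trans le_wu le_uv); rewrite ltnn.
Qed.

(** * Subtrees that need few deletions *)

Lemma parents_lt v u : u \in parents v -> phi u < phi v.
Proof. by rewrite inE => /and4P[]. Qed.

Lemma card_descendants_gt0 v : 0 < #|descendants v|.
Proof. by rewrite card_gt0; apply/set0Pn; exists v; exact: descendants_refl. Qed.

(* Once [Z] is deleted, one can delete all of [descendants w] but a set [R]
   without leaving a triangle that meets [R]; [g] measures the surplus over the
   ratio [3 : k + 3]. *)
Definition keepable (Z : {set V}) w g := exists R : {set V},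
  [/\ R \subset descendants w, 3 * #|descendants w| + g <= (k + 3) * #|R|
    & forall x y z, dtriangle A x y z -> x \in R ->
      (y \in Z :|: (descendants w :\: R)) || (z \in Z :|: (descendants w :\: R))].

Lemma dtriangle_nbrs w x y z : w \in A -> dtriangle A x y z ->
  x \in descendants w ->
  (y \in descendants w :|: parents w) /\ (z \in descendants w :|: parents w).
Proof.
move=> wA /and5P[xA yA zA xy /andP[yz zx]] xw.
split; apply: descendants_nbr xw _ _ => //; last exact: arc_h.
by rewrite h_sym; apply: arc_h.
Qed.

(** A triangle through [w] would need two vertices of [parents w] outside [Z]. *)
Lemma keepable1 (Z : {set V}) w : w \in A -> #|descendants w| = 1 ->
  #|parents w :\: Z| <= 1 -> keepable Z w k.
Proof.
move=> wA c1 cZ; exists (descendants w); split=> //; first by rewrite c1; lia.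
move=> x y z t xw; rewrite setDv setU0; apply/negPn/negP; rewrite negb_or => /andP[nyZ nzZ].
have [nxy nyz nzx] := dtriangle_neq t.
have [] := dtriangle_nbrs wA t xw.
have Ex u : u \in descendants w -> u = x.
  by move=> uw; apply: card_le1_eq uw xw; rewrite c1.
rewrite !(in_setU, in_setD); case/orP=> [/Ex e|yP]; first by rewrite e eqxx in nxy.
case/orP=> [/Ex e|zP]; first by rewrite e eqxx in nzx.
case/eqP: nyz; apply: card_le1_eq cZ _ _; rewrite inE; apply/andP; split=> //.
Qed.

Lemma keepable2 (Z : {set V}) w : w \in A -> #|descendants w| = 2 ->
  parents w \subset Z -> keepable Z w (2 * k).
Proof.
move=> wA c2 sZ; exists (descendants w); split=> //; first by rewrite c2; lia.
move=> x y z t xw; rewrite setDv setU0; apply/negPn/negP; rewrite negb_or => /andP[nyZ nzZ].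
have [nxy nyz nzx] := dtriangle_neq t.
have [] := dtriangle_nbrs wA t xw.
rewrite !(in_setU, in_setD); case/orP=> [yw|/(subsetP sZ)]; last by rewrite (negPf nyZ).
case/orP=> [zw|/(subsetP sZ)]; last by rewrite (negPf nzZ).
have : [set x; y; z] \subset descendants w.
  by apply/subsetP=> u; rewrite !inE => /orP[/orP[]|] /eqP->; move: xw yw zw; rewrite !inE.
move/subset_leq_card; rewrite c2 -setUA !cardsU1 cards1 !inE negb_or nxy eq_sym nzx.
by rewrite nyz.
Qed.

(* Two of the three descendants are both in-neighbours or both out-neighbours of
   the vertex [p] of [parents w :\: Z]: these two are kept. *)
Lemma keepable3 (Z : {set V}) w : w \in A -> 1 < k -> #|descendants w| = 3 ->
  #|parents w :\: Z| <= 1 -> keepable Z w (2 * k - 3).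
Proof.
move=> wA k1 c3 cZ.
have [p Pp] : exists p, forall u, u \in parents w -> u \notin Z -> u = p.
  case: (set_0Vmem (parents w :\: Z)) => [e|[p pP]].
    (* All of [parents w] lies in [Z], so [p] is arbitrary. *)
    exists w => u uP uZ; have : u \in parents w :\: Z by rewrite in_setD uZ uP.
    by rewrite e in_set0.
  by exists p => u uP uZ; apply: card_le1_eq cZ _ pP; rewrite in_setD uZ uP.
have [R [RD cR Rp]] : exists R : {set V}, [/\ R \subset descendants w, #|R| = 2
    & {in R &, forall x y, arc p x = arc p y}].
  pose side b := [set x in descendants w | arc p x == b].
  have [b] : exists b, 1 < #|side b|.
    have e : #|side true| + #|side false| = 3.
      rewrite -c3 -(cardsID [set x | arc p x] (descendants w)).
      by congr (_ + _); apply: eq_card => x; rewrite !inE; case: (arc p x); rewrite ?andbT ?andbF.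
    have [c|c] : 1 < #|side true| \/ 1 < #|side false| by lia.
      by exists true.
    by exists false.
  case/card_gt1P=> x [y []]; rewrite [x \in _]in_set [y \in _]in_set => /andP[xw /eqP px] /andP[yw /eqP py] nxy.
  exists [set x; y]; split; rewrite ?cards2 ?nxy //.
    by apply/subsetP=> u; rewrite in_set2 => /orP[]/eqP->.
  by move=> u u'; rewrite !in_set2 => /orP[]/eqP-> /orP[]/eqP->; rewrite ?px ?py.
(* As [1 < k], the truncated subtraction is exact: [9 + (2 * k - 3) = (k + 3) * 2]. *)
exists R; split=> //; first by rewrite c3 cR; lia.
move=> x y z t xR; apply/negPn/negP; rewrite negb_or => /andP[ny nz].
have [nxy nyz nzx] := dtriangle_neq t.
have [] := dtriangle_nbrs wA t (subsetP RD x xR).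
have Ru u : u \notin Z :|: (descendants w :\: R) ->
    u \in descendants w :|: parents w -> u \in R \/ u = p.
  rewrite !in_setU in_setD negb_or negb_and negbK => /andP[uZ uR] /orP[uw|uP].
    by left; move: uR; rewrite uw orbF.
  by right; apply: Pp.
move/(Ru _ ny)=> yR /(Ru _ nz) zR.
have /and5P[_ _ _ xy /andP[yz zx]] := t.
have two (a b c : V) : a \in R -> b \in R -> c \in R -> a != b -> b != c -> c != a -> False.
  move=> aR bR cR' nab nbc nca.
  have : [set a; b; c] \subset R by apply/subsetP=> u; rewrite !inE => /orP[/orP[]|] /eqP->.
  by move/subset_leq_card; rewrite cR -setUA !cardsU1 cards1 !inE negb_or nab eq_sym nca nbc.
case: yR zR => [yR|ey] [zR|ez].
- exact: (two x y z).
(* A triangle has one arc into [p] and one out of it, so its other two vertices would lie on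
   different sides of [p]. *)
- by have := Rp _ _ xR yR; rewrite -ez zx (negPf (arc_asym yz)).
- by have := Rp _ _ xR zR; rewrite -ey yz (negPf (arc_asym xy)).
- by rewrite ey ez eqxx in nyz.
Qed.

(** The surpluses of the disjoint subtrees pay for [X0], of which [R0] is kept. A triangle through
    [R0] that enters a subtree at a kept vertex is handled, after rotation, by the keepability of
    that subtree. *)
Lemma keepable_reducible v (T X0 R0 : {set V}) (g : V -> nat) :
  v \in A -> T \subset children v -> T != set0 ->
  R0 \subset X0 -> X0 \subset v |: parents v ->
  3 * #|X0| <= (k + 3) * #|R0| + \sum_(w in T) g w ->
  {in T, forall w, keepable (X0 :\: R0) w (g w)} ->
  (forall x y z, dtriangle A x y z -> x \in R0 -> exists2 u, u \in [set y; z] &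
     u \in (X0 :\: R0) :|: \bigcup_(w in T) descendants w) ->
  reducible A.
Proof.
move=> vA Tv T0 R0X X0B leg keepT triR0.
have /fin_all_exists[F FP] : forall w, exists R : {set V}, w \in T ->
    [/\ R \subset descendants w, 3 * #|descendants w| + g w <= (k + 3) * #|R|
    & forall x y z, dtriangle A x y z -> x \in R ->
      (y \in (X0 :\: R0) :|: (descendants w :\: R))
      || (z \in (X0 :\: R0) :|: (descendants w :\: R))].
  move=> w; case: (boolP (w \in T)) => [/keepT[R RP]|_]; last by exists set0.
  by exists R.
have X0D w u : w \in T -> u \in X0 -> u \notin descendants w.
  move=> wT /(subsetP X0B) uB; apply: (low_not_descendant (subsetP Tv w wT)).
  by move: uB; rewrite in_setU1 => /orP[/eqP->//|/parents_lt/ltnW].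
have disD : {in T &, forall w w', w != w' -> [disjoint descendants w & descendants w']}.
  by move=> w w' wT w'T; apply: descendants_children_disjoint; apply: (subsetP Tv).
have FD w : w \in T -> F w \subset descendants w by case/FP.
have disF : {in T &, forall w w', w != w' -> [disjoint F w & F w']}.
  move=> w w' wT w'T nww'; apply: disjointWl (FD w wT) _.
  by apply: disjointWr (FD w' w'T) _; apply: disD.
pose X := X0 :|: \bigcup_(w in T) descendants w.
pose R := R0 :|: \bigcup_(w in T) F w.
have inXR0 u : u \in X0 :\: R0 -> u \in X :\: R.
  rewrite in_setD => /andP[uR0 uX0]; rewrite in_setD !in_setU uX0 (negPf uR0) andbT /=.
  by apply/bigcupP=> -[w wT /(subsetP (FD w wT))]; rewrite (negPf (X0D w u wT uX0)).
have inXD w u : w \in T -> u \in descendants w :\: F w -> u \in X :\: R.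
  move=> wT; rewrite in_setD => /andP[uF uw]; rewrite in_setD !in_setU.
  have uX0 : u \notin X0 by apply: contraL uw; apply: X0D.
  have -> : u \in \bigcup_(w in T) descendants w by apply/bigcupP; exists w.
  rewrite orbT andbT negb_or (contra (subsetP R0X u) uX0) /=.
  apply/bigcupP=> -[w' w'T uw']; have [e|nww'] := eqVneq w w'.
    by rewrite e uw' in uF.
  by have := subsetP (FD w' w'T) u uw'; rewrite (disjointFr (disD w w' wT w'T nww') uw).
have triF w x y z : w \in T -> dtriangle A x y z -> x \in F w ->
    (y \in X :\: R) || (z \in X :\: R).
  move=> wT t xF; have [_ _ /(_ x y z t xF)] := FP w wT.
  by case/orP; rewrite in_setU => /orP[/inXR0->|/(inXD w _ wT)->]; rewrite ?orbT.
have R0X0 x : x \in R0 -> (x \in X :\: R) = false.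
  by move=> xR; rewrite in_setD in_setU xR.
exists X, R; split.
- have [w wT] := set0Pn _ T0; apply/set0Pn; exists w; rewrite in_setU.
  by apply/orP; right; apply/bigcupP; exists w => //; apply: descendants_refl.
- apply: setUSS => //; apply/bigcupsP=> w wT; apply: subset_trans (FD w wT) _.
  exact: bigcup_sup.
- rewrite subUset; apply/andP; split.
    by apply: subset_trans X0B _; rewrite subUset sub1set vA parents_sub.
  apply/bigcupsP=> w wT; apply: descendants_sub.
  exact: children_in (subsetP Tv w wT).
- have cX : #|X| <= #|X0| + \sum_(w in T) #|descendants w|.
    by apply: leq_trans (leq_card_setU _ _) _; rewrite leq_add2l card_bigcup_le.
  have cR : #|R| = #|R0| + \sum_(w in T) #|F w|.
    rewrite cardsU (_ : R0 :&: _ = set0) ?cards0 ?subn0 ?card_bigcup_disjoint //.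
    apply/eqP; rewrite setI_eq0; apply/pred0P=> u /=; apply/negP=> /andP[/(subsetP R0X) uX0].
    by case/bigcupP=> w wT /(subsetP (FD w wT)); rewrite (negPf (X0D w u wT uX0)).
  have : \sum_(w in T) (3 * #|descendants w| + g w) <= \sum_(w in T) (k + 3) * #|F w|.
    by apply: leq_sum => w /FP[].
  rewrite big_split /= -!big_distrr /= cR mulnDr; lia.
- move=> x y z t; rewrite in_setU => /orP[xR0|/bigcupP[w wT]]; last exact: triF t.
  have [u] := triR0 x y z t xR0.
  rewrite in_set2 in_setU => uyz /orP[/inXR0 uX|/bigcupP[w wT uw]].
    by case/orP: uyz => /eqP<-; rewrite uX ?orbT.
  have [uF|uF] := boolP (u \in F w); last first.
    have uX : u \in X :\: R by apply: (inXD w) => //; rewrite in_setD uF.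
    by case/orP: uyz => /eqP<-; rewrite uX ?orbT.
  case/orP: uyz => /eqP e; rewrite e in uF.
    by have := triF w _ _ _ wT (dtriangle_rot t) uF; rewrite (R0X0 x xR0) orbF => ->; rewrite orbT.
  by have := triF w _ _ _ wT (dtriangle_rot (dtriangle_rot t)) uF; rewrite (R0X0 x xR0) /= => ->.
Qed.

Lemma keepable_root v g :
  v \in A -> keepable set0 v g -> reducible A.
Proof.
move=> vA [R [RD cR tR]]; exists (descendants v), R; split=> //.
- by rewrite -card_gt0 card_descendants_gt0.
- exact: descendants_sub.
- by apply: leq_trans cR; rewrite leq_addr.
- by move=> x y z t xR; have := tR x y z t xR; rewrite set0U.
Qed.

Definition surplus w :=
  if #|descendants w| == 1 then k else 2 * k - 3.

Lemma keepable_surplus (Z : {set V}) w : w \in A -> 1 < k ->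
  (#|descendants w| == 1) || (#|descendants w| == 3) ->
  #|parents w :\: Z| <= 1 -> keepable Z w (surplus w).
Proof.
move=> wA k1 c cZ; rewrite /surplus; case: eqP => [c1|/eqP c1]; first exact: keepable1.
by apply: keepable3 => //; apply/eqP; rewrite (negPf c1) in c.
Qed.

(** * Reductions around a vertex whose children have small subtrees *)

Lemma card_parents_child v w : w \in children v -> #|parents w :\: parents v| <= 1.
Proof.
move=> wv; rewrite -(cards1 v); apply: subset_leq_card; apply/subsetP=> u.
rewrite in_setD => /andP[uv /(subsetP (parents_child wv))].
by rewrite in_setU1 (negPf uv) orbF in_set1.
Qed.

Lemma descendants_bigcup v :
  descendants v \subset v |: \bigcup_(w in children v) descendants w.
Proof.
apply/subsetP=> y yv; rewrite in_setU1; have [//|nyv] := eqVneq y v.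
by have [w wv yw] := descendants_child yv nyv; apply/bigcupP; exists w.
Qed.

Lemma card_descendants_le v :
  #|descendants v| <= (\sum_(w in children v) #|descendants w|).+1.
Proof.
apply: leq_trans (subset_leq_card (descendants_bigcup v)) _.
apply: leq_trans (leq_card_setU _ _) _; rewrite cards1 add1n ltnS.
exact: card_bigcup_le.
Qed.

(* A triangle through [v] avoiding the children has its two other vertices
   among the parents of [v], of which at most one is not deleted. *)
Lemma keep_parent_reducible v (Z : {set V}) : v \in A -> 1 < k ->
  children v != set0 -> Z \subset parents v -> #|parents v :\: Z| <= 1 ->
  {in children v, forall w,
     (#|descendants w| == 1) || (#|descendants w| == 3)} ->
  {in children v, forall w, #|parents w :\: Z| <= 1} ->
  3 * #|Z| <= k + \sum_(w in children v) surplus w ->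
  reducible A.
Proof.
move=> vA k1 ch0 Zv cZ cD cw le.
have vZ : v \notin Z by apply/negP=> /(subsetP Zv)/parents_lt; rewrite ltnn.
have eZ : (v |: Z) :\: [set v] = Z.
  by apply/setP=> u; rewrite !inE; case: eqVneq => [->|//]; rewrite (negPf vZ).
apply: (@keepable_reducible v (children v) (v |: Z) [set v] surplus) => //.
- by rewrite sub1set setU11.
- exact: setUS.
- by rewrite cardsU1 vZ cards1; lia.
- move=> w wv; rewrite eZ; apply: keepable_surplus => //; [exact: children_in wv|exact: cD|exact: cw].
- move=> x y z t; rewrite in_set1 => /eqP ex; rewrite eZ.
  have [nxy nyz nzx] := dtriangle_neq t.
  have xv : x \in descendants v by rewrite ex descendants_refl.
  have [yv zv] := dtriangle_nbrs vA t xv.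
  set U := Z :|: _.
  have inU u : u != x -> u \in descendants v :|: parents v -> u \notin U -> u \in parents v :\: Z.
    move=> nux; rewrite in_setU in_setD in_setU negb_or => /orP[uv|->] /andP[-> //].
    by have := subsetP (descendants_bigcup v) u uv; rewrite in_setU1 -ex (negPf nux) /= => ->.
  have [yU|yU] := boolP (y \in U); first by exists y => //; rewrite set21.
  have [zU|zU] := boolP (z \in U); first by exists z => //; rewrite set22.
  have yP : y \in parents v :\: Z by apply: inU => //; rewrite eq_sym.
  have zP := inU z nzx zv zU.
  by rewrite (card_le1_eq cZ yP zP) eqxx in nyz.
Qed.

Lemma pair_child_reducible v w w' : v \in A -> 2 < k ->
  w \in children v -> w' \in children v -> w != w' ->
  #|descendants w| = 2 -> #|descendants w'| <= 3 -> reducible A.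
Proof.
move=> vA k2 wv w'v nww' c2 c3; have c0 := card_descendants_gt0 w'.
have vP : v \notin parents v by apply/negP=> /parents_lt; rewrite ltnn.
have cB : #|v |: parents v| <= k.+1 by rewrite cardsU1 vP add1n ltnS card_parents.
have sumT (g : V -> nat) : \sum_(u in [set w; w']) g u = g w + g w'.
  by rewrite big_setU1 ?in_set1 // big_set1.
have sT : [set w; w'] \subset children v.
  by apply/subsetP=> u; rewrite !in_set2 => /orP[]/eqP->.
have T0 : [set w; w'] != set0 by apply/set0Pn; exists w; rewrite set21.
have wA := children_in wv; have w'A := children_in w'v.
have [c2'|/eqP nc2] := eqVneq #|descendants w'| 2.
  (* Since [k >= 3], the surplus [4 * k] pays for all [k + 1] vertices. *)
  apply: (@keepable_reducible v [set w; w'] (v |: parents v) set0 (fun=> 2 * k)) => //.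
  - exact: sub0set.
  - by rewrite sumT cards0; lia.
  - move=> u; rewrite setD0 in_set2 => /orP[]/eqP->; apply: keepable2 => //; exact: parents_child.
  - by move=> x y z _; rewrite in_set0.
(* Now only a surplus of [3 * k] is guaranteed, so [X] spares a vertex outside [parents w]. If there
   is none, [v |: parents v] lies in [parents w] and has at most [k] vertices. *)
have [X [XB cX wX w'X]] : exists X : {set V}, [/\ X \subset v |: parents v, #|X| <= k,
    parents w \subset X & #|parents w' :\: X| <= 1].
  have [e|[x]] := set_0Vmem ((v |: parents v) :\: parents w).
    have sB : v |: parents v \subset parents w by rewrite -setD_eq0 e.
    exists (v |: parents v); split=> //; last 2 first.
    - exact: parents_child.
    - have /eqP-> : parents w' :\: (v |: parents v) == set0 by rewrite setD_eq0 parents_child.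
      by rewrite cards0.
    by apply: leq_trans (subset_leq_card sB) (card_parents w).
  rewrite in_setD => /andP[xw xB].
  exists ((v |: parents v) :\ x); split.
  - exact: subD1set.
  - by move: cB; rewrite (cardsD1 x) xB.
  - by rewrite subsetD1 parents_child.
  - rewrite -(cards1 x); apply: subset_leq_card; apply/subsetP=> u.
    rewrite in_setD in_setD1 in_set1 negb_and negbK => /andP[/orP[//|uB]].
    by move/(subsetP (parents_child w'v)); rewrite (negPf uB).
apply: (@keepable_reducible v [set w; w'] X set0
  (fun u => if u == w then 2 * k else surplus u)) => //.
- exact: sub0set.
- rewrite sumT cards0 eqxx eq_sym (negPf nww') /surplus.
  by case: ifP => _; lia.
- move=> u; rewrite setD0 in_set2; case: eqVneq => [-> _|_ /eqP->] //.
    exact: keepable2.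
  by apply: keepable_surplus => //; [lia | move/eqP: nc2; lia].
- by move=> x y z _; rewrite in_set0.
Qed.

(* For [k = 2] the surplus of a three-vertex piece is too small, which is why
   [m] has to be smaller then. *)
Lemma large_descendants_reducible v m : v \in A -> 1 < k ->
  m = (if k == 2 then 1 else 3) -> m < #|descendants v| ->
  {in children v, forall w, #|descendants w| <= m} -> reducible A.
Proof.
move=> vA k1 em mv mch.
have surk w : w \in children v -> k <= surplus w.
  by move=> wv; have := mch w wv; have := card_descendants_gt0 w; rewrite /surplus em; case: eqP; case: eqP; lia.
have ch0 : children v != set0.
  apply: contraTneq mv => e; have := card_descendants_le v; rewrite e big_set0.
  by rewrite em; case: ifP; lia.
have [/exists_inP[w wv /eqP c2]|] := boolP [exists w in children v, #|descendants w| == 2].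
  have k2 : 2 < k by have := mch w wv; rewrite c2 em; case: eqP; lia.
  have m3 : m = 3 by rewrite em; case: eqP; lia.
  (* If [w] were the only child, [v] would have at most three descendants. *)
  have [e|[w']] := set_0Vmem (children v :\ w); last first.
    rewrite in_setD1 => /andP[nw w'v]; apply: (@pair_child_reducible v w w') => //.
      by rewrite eq_sym.
    by rewrite -m3 mch.
  have := card_descendants_le v; rewrite (big_setD1 w) //= e big_set0; lia.
rewrite negb_exists_in => /forall_inP no2.
have c13 : {in children v, forall w, (#|descendants w| == 1) || (#|descendants w| == 3)}.
  move=> w wv; have := mch w wv; have := no2 w wv; have := card_descendants_gt0 w.
  by rewrite em; case: ifP; lia.
have cP := card_parents v.
have [c|c] := leqP 2 #|children v|.
  (* Keeping [v] yields [k] and two children yield at least [2 * k], which pays for all parents. *)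
  apply: (@keep_parent_reducible v (parents v)) => //.
  - by rewrite setDv cards0.
  - exact: card_parents_child.
  - have : \sum_(w in children v) k <= \sum_(w in children v) surplus w by apply: leq_sum.
    by rewrite sum_nat_const; nia.
have /cards1P[w ew] : #|children v| == 1 by rewrite eqn_leq -ltnS c card_gt0.
have wv : w \in children v by rewrite ew set11.
(* The only child has exactly [m] descendants, as [v] has at most one more. *)
have sur : 2 * k <= surplus w + 3.
  have := card_descendants_le v; rewrite ew big_set1 /surplus => le.
  by move: mv; rewrite em; case: eqP; case: eqP; lia.
have vw : v \in parents w by move: wv; rewrite inE => /andP[].
(* Only [k - 1] deletions are affordable. The spared vertex must not be a parent of [w]; if all
   parents of [v] are, they and [v] number at most [k] together, and none has to be spared. *)
have [Z [Zv cZ cZw cZ']] : exists Z : {set V}, [/\ Z \subset parents v,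
    #|parents v :\: Z| <= 1, #|parents w :\: Z| <= 1 & #|Z| < k].
  have [e|[x]] := set_0Vmem (parents v :\: parents w).
    exists (parents v); split=> //; [by rewrite setDv cards0|exact: card_parents_child|].
    have sub : parents v \subset parents w :\ v.
      rewrite subsetD1 -setD_eq0 e eqxx /=.
      by apply/negP=> /parents_lt; rewrite ltnn.
    by have := subset_leq_card sub; have := card_parents w; rewrite (cardsD1 v) vw; lia.
  rewrite in_setD => /andP[xw xv]; exists (parents v :\ x); split.
  - exact: subD1set.
  - by rewrite setDDr setDv set0U; apply: leq_trans (subset_leq_card (subsetIr _ _)) _; rewrite cards1.
  - apply: leq_trans (card_parents_child wv); apply: subset_leq_card; apply/subsetP=> u.
    rewrite !in_setD in_set1 negb_and negbK => /andP[/orP[/eqP->|->] uw]; last by rewrite uw.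
    by rewrite uw in xw.
  - by move: cP; rewrite (cardsD1 x) xv; lia.
apply: (@keep_parent_reducible v Z) => //.
- by move=> u; rewrite ew in_set1 => /eqP->.
- by rewrite ew big_set1; lia.
Qed.

Lemma nonempty_reducible : 1 < k -> A != set0 -> reducible A.
Proof.
move=> k1 /set0Pn[v0 v0A].
pose m := if k == 2 then 1 else 3.
pose big v := (v \in A) && (m < #|descendants v|).
have [v1 v1b|nobig] := pickP big.
  case: (arg_maxnP phi v1b) => v /andP[vA mv] vmax.
  apply: (@large_descendants_reducible v m) => // w wv.
  rewrite leqNgt; apply/negP=> mw.
  have /vmax : big w by rewrite /big (children_in wv).
  by rewrite /= leqNgt (children_gt wv).
(* The first vertex of [A] has no parents, so its descendants form a component. *)
case: (arg_minnP phi v0A) => v; rewrite -/(v \in A) => vA vmin.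
have P0 : parents v = set0.
  apply/setP=> u; rewrite in_set0; apply/negP=> uv.
  have := vmin u (subsetP (parents_sub v) u uv).
  by rewrite leqNgt (parents_lt uv).
have cv : #|descendants v| <= 3.
  by have := nobig v; rewrite /big vA /m /=; case: ifP; lia.
have [c2|nc2] := eqVneq #|descendants v| 2.
  by apply: keepable_root vA (keepable2 vA c2 _); rewrite P0 sub0set.
apply: keepable_root vA (keepable_surplus vA k1 _ _); last by rewrite P0 set0D cards0.
by have := card_descendants_gt0 v; lia.
Qed.

End Subgraph.

(** * Feedback vertex sets in bounded treewidth *)

Lemma exists_large_dtriangle_free :
  exists S : {set V}, (forall x y z, ~~ dtriangle S x y z) /\
     3 * #|V| <= (k + 3) * #|S|.
Proof.
have [k1|k1] := leqP k 1; last first.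
  by apply: large_dtriangle_free => A; apply: nonempty_reducible.
(* For [k <= 1] everything is kept: the last vertex of a triangle would have two earlier
   neighbours. *)
apply: large_dtriangle_free => A A0; exists A, A; split=> //.
  by rewrite leq_mul2r leq_addl orbT.
move=> x y z t _; have [x' [y' [z' [t' lx ly]]]] : exists x' y' z',
    [/\ dtriangle A x' y' z', phi x' <= phi z' & phi y' <= phi z'].
  have t1 := dtriangle_rot t; have t2 := dtriangle_rot t1.
  have [H|[H|H]] : phi x <= phi z /\ phi y <= phi z \/
    (phi y <= phi x /\ phi z <= phi x \/ phi z <= phi y /\ phi x <= phi y) by lia.
  - by exists x, y, z; case: H.
  - by exists y, z, x; case: H.
  - by exists z, x, y; case: H.
have [nxy nyz nzx] := dtriangle_neq t'.
have /and5P[_ _ _ xy /andP[yz zx]] := t'.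
have lt u : u != z' -> phi u <= phi z' -> phi u < phi z'.
  by move=> nu; rewrite leq_eqVlt => /orP[/eqP/phi_inj e|//]; rewrite e eqxx in nu.
have : [set x'; y'] \subset [set u | h u z' & phi u < phi z'].
  apply/subsetP=> u; rewrite in_set2 inE => /orP[]/eqP->; rewrite lt // ?andbT.
  - by rewrite h_sym arc_h.
  - by rewrite eq_sym.
  - exact: arc_h.
move/subset_leq_card; rewrite cards2 nxy; have := h_back z'; lia.
Qed.

End EliminationOrder.

(* f(G) <= k/(k+3) n(G), i.e. some feedback vertex set F has
   (k+3)|F| <= k |V|. *)
Theorem mainTheorem7 (k : nat) (V : finType) (arc : rel V) :
  oriented arc -> tw_le k arc ->
  exists F : {set V}, is_fvs arc F /\ ((k + 3) * #|F| <= k * #|V|)%N.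
Proof.
case=> arc_irr arc_asym [W [h [f [[h_irr [h_sym [phi [phi_inj phiP]]]] f_inj arc_f]]]].
pose hV x y := h (f x) (f y).
pose pV x := nat_of_ord (phi (f x)).
(* A dicycle-free set is determined by its triangles only if every edge of the
   k-tree is oriented, hence the extra arcs. *)
pose arc' x y := arc x y || [&& hV x y, ~~ arc y x & pV x < pV y].
have arc_hV x y : arc x y -> hV x y by move=> xy; apply: arc_f; rewrite /underlying xy.
have pV_inj : injective pV by move=> x y /ord_inj/phi_inj/f_inj.
have arc'_asym x y : arc' x y -> ~~ arc' y x.
  rewrite /arc' negb_or => /orP[xy|/and3P[hxy nyx lt]].
    by rewrite (arc_asym _ _ xy) xy /= andbF.
  by rewrite nyx ltnNge (ltnW lt) !andbF.
have hV_sym : symmetric hV by move=> x y; rewrite /hV h_sym.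
have hV_irr : irreflexive hV by move=> x; rewrite /hV h_irr.
have hV_chordal u v w : hV u w -> hV v w -> pV u < pV w -> pV v < pV w -> u != v -> hV u v.
  move=> hu hv lu lv nuv; have [cl _] := phiP (f w).
  by apply: cl; rewrite ?(inj_eq f_inj) // inE; apply/andP.
have arc'_h x y : arc' x y -> hV x y by case/orP=> [/arc_hV|/and3P[]].
have arc'_total x y : hV x y -> arc' x y || arc' y x.
  move=> hxy; have hyx : hV y x by rewrite hV_sym.
  rewrite /arc' hxy hyx.
  case: (arc x y) (arc y x) => [] [] //=.
  by case: ltngtP => // /pV_inj e; rewrite e hV_irr in hxy.
have [S [tS cS]] : exists S : {set V}, (forall x y z, ~~ dtriangle arc' S x y z) /\
    3 * #|V| <= (k + 3) * #|S|.
  apply: (@exists_large_dtriangle_free V hV arc' pV k) => //.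
  move=> v; have [_ cP] := phiP (f v); rewrite -(card_imset _ f_inj).
  apply: leq_trans (geq_minl k (phi (f v))); rewrite -cP.
  apply: subset_leq_card; apply/subsetP=> _ /imsetP[u + ->].
  by rewrite !inE.
exists (~: S); split.
  rewrite /is_fvs setCK => -[s [s0 us sS cs]].
  apply: (@dtriangle_free_acyclic V hV arc' pV _ _ _ _ _ _ _ S tS) => //.
  by exists s; split=> //; apply: sub_cycle cs => x y xy; rewrite /arc' xy.
have := cardsC S; nia.
Qed.
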